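(* Let $0 < \alpha < \beta$ be real numbers, and let $\theta, \delta, \sigma$, the numbers $\sigma_k$ ($k\ge 0$) and the numbers $\zeta_j$ ($j \ge 0$) be defined from $\alpha,\beta$ as in the context. For $j \ge 0$ and $k = 2^j$ put $\chi_{j+1} = \dfrac{2\sigma_k^2}{\sigma_{2k}}$. Let $(p_{2^j-1})_{j \ge 0}$ be the sequence of polynomials defined by $$p_0(x) = \frac{1}{\theta}, \qquad p_{2k-1}(x) = \frac{2\sigma_k^2}{\sigma_{2k}}\left(2 p_{k-1}(x) - x\, p_{k-1}^2(x)\right) = \chi_{j+1}\left(2 p_{k-1}(x) - x\, p_{k-1}^2(x)\right), \quad k = 2^j,\ j \ge 0.$$ Then this sequence satisfies the Newton recurrence $$p_0(x) = \zeta_0, \qquad p_{2^{j+1}-1}(x) = \zeta_{j+1}\left(2 p_{2^j-1}(x) - x\, p_{2^j-1}^2(x)\right), \quad j \ge 0.$$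
   Context: Chebyshev side. Given real numbers $0<\alpha<\beta$ (endpoints of an interval containing the spectrum of a symmetric positive definite matrix), set $\theta = \frac{\beta+\alpha}{2}$, $\delta = \frac{\beta-\alpha}{2}$, $\sigma = \frac{\theta}{\delta}$. Let $T_k$ be the Chebyshev polynomials of the first kind and $\sigma_k = T_k(\sigma)$, i.e. $\sigma_0 = 1$, $\sigma_1 = \sigma$, $\sigma_{k+1} = 2\sigma\sigma_k - \sigma_{k-1}$ for $k\ge 1$; in particular $\sigma_{2k} = 2\sigma_k^2 - 1$. Newton side. With $\alpha_0 = \alpha$ and $\beta_0 = \beta$, the scaling factors are $$\zeta_0 = \frac{2}{\alpha_0+\beta_0}, \qquad \zeta_1 = \frac{2}{1 + 2\alpha_0\zeta_0 - (\alpha_0\zeta_0)^2}, \qquad \zeta_i = \frac{2}{1 + 2\zeta_{i-1} - \zeta_{i-1}^2}\quad (i \ge 2).$$ *)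

(* Defs.v *)
From mathcomp Require Import all_boot all_order all_algebra.

Set Implicit Arguments.
Unset Strict Implicit.
Unset Printing Implicit Defensive.

Import Order.TTheory GRing.Theory Num.Theory.
Local Open Scope ring_scope.

Section Defs.
Variable R : realFieldType.

Fixpoint chebyshevT (k : nat) : {poly R} :=
  match k with
  | 0 => 1
  | 1 => 'X
  | (n.+1 as m).+1 => 2 * 'X * chebyshevT m - chebyshevT n
  end.

Definition theta (alpha beta : R) : R := (beta + alpha) / 2.

Definition delta (alpha beta : R) : R := (beta - alpha) / 2.

Definition sigma (alpha beta : R) : R := theta alpha beta / delta alpha beta.

Definition sigmak (alpha beta : R) (k : nat) : R :=
  (chebyshevT k).[sigma alpha beta].

(* Only meaningful for positive indices: chi_(j+1) = 2 sigma_k^2 / sigma_(2k)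
   with k = 2^j. *)
Definition chi (alpha beta : R) (i : nat) : R :=
  let k := (2 ^ i.-1)%N in
  2 * sigmak alpha beta k ^+ 2 / sigmak alpha beta (2 * k)%N.

Fixpoint zeta (alpha beta : R) (i : nat) : R :=
  match i with
  | 0 => 2 / (alpha + beta)
  | 1 => let a := alpha * (2 / (alpha + beta)) in 2 / (1 + 2 * a - a ^+ 2)
  | (_.+1 as m).+1 =>
      let z := zeta alpha beta m in 2 / (1 + 2 * z - z ^+ 2)
  end.

End Defs.

(* Main.v *)
(* Doubling T_2k = 2 T_k^2 - 1 turns chi_(j+1) into 2 / (2 - sigma_k^-2), and
   the zeta recurrence reads zeta' = 2 / (2 - (1 - zeta)^2).  Both sequences
   agree because 1 - chi_(j+1) = - 1 / sigma_2k, while initially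
   1 - alpha zeta_0 = delta / theta = 1 / sigma. *)

Require Import Defs.
From mathcomp Require Import all_boot all_order all_algebra.
From mathcomp Require Import ring lra.

Set Implicit Arguments.
Unset Strict Implicit.
Unset Printing Implicit Defensive.

Import Order.TTheory GRing.Theory Num.Theory.
Local Open Scope ring_scope.

Section ChebyshevNewton.
Variables (R : realFieldType) (alpha beta : R).

Local Notation s := (sigmak alpha beta).

Lemma sigmak1 : s 1 = sigma alpha beta.
Proof. by rewrite /sigmak /= hornerX. Qed.

Lemma sigmakSS n : s n.+2 = 2 * s 1 * s n.+1 - s n.
Proof.
by rewrite sigmak1 /sigmak [chebyshevT R n.+2]/= !hornerE.
Qed.

(* Invariant quadratic form of the three-term recurrence. *)
Lemma sigmak_quadratic n :
  s n.+1 ^+ 2 - 2 * s 1 * s n * s n.+1 + s n ^+ 2 = 1 - s 1 ^+ 2.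
Proof.
elim: n => [|n IHn]; last by rewrite -IHn sigmakSS; ring.
by rewrite [s 0]hornerC; ring.
Qed.

(** Two consecutive indices are treated together, since the three-term recurrence needs both values
    to advance. *)
Lemma sigmak_double_pair n :
  s (2 * n) = 2 * s n ^+ 2 - 1 /\ s (2 * n).+1 = 2 * s n * s n.+1 - s 1.
Proof.
elim: n => [|n [IH0 IH1]]; first by rewrite muln0 [s 0]hornerC; split; ring.
have E : s (2 * n).+2 = 2 * s n.+1 ^+ 2 - 1.
  (* Twice the invariant at [n] trades the cross term [s 1 * s n * s n.+1] for squares. *)
  by rewrite sigmakSS IH0 IH1; have := sigmak_quadratic n; nra.
by rewrite mulnS; split=> //; rewrite [LHS]sigmakSS E IH1 sigmakSS; ring.
Qed.

Lemma sigmak_double n : s (2 * n) = 2 * s n ^+ 2 - 1.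
Proof. by case: (sigmak_double_pair n). Qed.

(** The map [t -> 2 * t ^+ 2 - 1] preserves [t > 1], and [sigma = (beta + alpha) / (beta - alpha) >
    1]. *)
Lemma sigmak_pow2_gt1 j : 0 < alpha -> alpha < beta -> 1 < s (2 ^ j).
Proof.
move=> alpha_gt0 alpha_lt_beta; elim: j => [|j IHj]; last first.
  by rewrite expnS sigmak_double; nra.
rewrite sigmak1 /sigma /theta /delta ltr_pdivlMr; lra.
Qed.

(** Index 0 is left out: [zeta_0 = 1 / theta] is the constant [p 0], not a factor [chi]. *)
Lemma zeta_chi j :
  0 < alpha -> alpha < beta -> zeta alpha beta j.+1 = chi alpha beta j.+1.
Proof.
move=> alpha_gt0 alpha_lt_beta; elim: j => [|j IHj].
  rewrite /chi /= sigmak_double sigmak1 /sigma /theta /delta.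
  by field; apply/and3P; split; apply: lt0r_neq0; nra.
rewrite [LHS]/= -/(zeta alpha beta j.+1) IHj /chi /= -expnS sigmak_double.
rewrite expnS sigmak_double.
have := sigmak_pow2_gt1 j alpha_gt0 alpha_lt_beta; set t := s _ => t_gt1.
(* This is [s (2 ^ j.+1) > 1], which keeps the denominators nonzero. *)
have u_gt1 : 1 < 2 * t ^+ 2 - 1 by nra.
by field; apply/andP; split; apply: lt0r_neq0; nra.
Qed.

End ChebyshevNewton.

(* p is indexed by degree; only its values at the indices 2^j - 1 are
   constrained or used. *)
Theorem theorem3p1 (R : realFieldType) (alpha beta : R)
    (alpha_gt0 : 0 < alpha) (alpha_lt_beta : alpha < beta)
    (p : nat -> {poly R})
    (p0E : p 0%N = (1 / theta alpha beta)%:P)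
    (pE : forall j : nat, let k := (2 ^ j)%N in
      p (2 * k - 1)%N =
        chi alpha beta j.+1 *: (2 * p (k - 1)%N - 'X * p (k - 1)%N ^+ 2)) :
  p 0%N = (zeta alpha beta 0)%:P /\
  (forall j : nat,
    p (2 ^ j.+1 - 1)%N =
      zeta alpha beta j.+1 *:
        (2 * p (2 ^ j - 1)%N - 'X * p (2 ^ j - 1)%N ^+ 2)).
Proof.
split=> [|j].
  by rewrite p0E /theta /=; congr _%:P; field; apply: lt0r_neq0; lra.
by rewrite expnS pE zeta_chi.
Qed.
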